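(* Let $G$ be a finite graph and let $\mathcal{C}(G)=(C^i(G),d)$ be the graded chain complex of enhanced states of $G$ defined in the context. Then the graded Euler characteristic of $\mathcal{C}(G)$ is equal to $J_G(q)=P_G\big(q,\tfrac{q^2}{q-1}\big)$, expanded as a series in $q^{-1}$ via $\tfrac{q^2}{q-1}=\sum_{i\ge 0}q^{1-i}$.
   Context: Graphs are finite, loops and multiple edges being allowed. For a graph $G$ with vertex set $V(G)$ and edge set $E(G)$ and $s\subset E(G)$, let $[G:s]$ be the graph with vertex set $V(G)$ and edge set $s$, and let $k(s)$ be its number of connected components. The dichromatic polynomial $P_G(q,v)$ is determined by $P_G=P_{G-e}-qP_{G/e}$ for every edge $e$ (deletion and contraction), and $P_{N_k}=v^k$ for the graph $N_k$ with $k$ vertices and no edges; equivalently $P_G(q,v)=\sum_{s\subset E(G)}(-1)^{|s|}q^{|s|}v^{k(s)}$. For a $\mathbb{Z}$-graded $\mathbb{Z}$-module $M=\bigoplus_k M_k$, the graded dimension is $q\dim M=\sum_k q^k\,\mathrm{rank}(M_k)$ with $\mathrm{rank}(M_k)=\dim_{\mathbb{Q}}(M_k\otimes\mathbb{Q})$. The graded Euler characteristic of a graded chain complex with chain groups in positions $0\le i\le m$ is $\sum_{0\le i\le m}(-1)^i q\dim(H^i)$, where $H^i$ are the homology groups. Enhanced states. Let $m=|E(G)|$ and fix a total ordering of $E(G)$. An enhanced state is a pair $S=(s,l)$, where $s\subset E(G)$ and $l$ is a labeling of the connected components of $[G:s]$ by nonnegative integers; $|l|$ denotes the sum of the labels.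 Put $i(S)=|s|$ and $j(S)=|s|+k(s)-|l|$. Let $C^{i,j}(G)$ ($0\le i\le m$, $j\in\mathbb{Z}$) be the free $\mathbb{Z}$-module spanned by all enhanced states $S$ of $G$ with $i(S)=i$, $j(S)=j$, and let $C^i(G)=\bigoplus_{j\in\mathbb{Z}}C^{i,j}(G)$, graded by $j$. The differential $d:C^{i,j}(G)\to C^{i+1,j}(G)$ is given on enhanced states $S=(s,l)$ by $d(S)=\sum_{e\in E(G)\setminus s}(-1)^{n_e}S_e$, where $n_e$ is the number of edges in $s$ ordered before $e$, and $S_e=(s_e,l_e)$ with $s_e=s\cup\{e\}$ and $l_e$ defined as follows. Let $E_1,\dots,E_k$ be the components of $[G:s]$. If $e$ connects some $E_i$ to itself, then $l_e(E_i\cup\{e\})=l(E_i)+1$ and $l_e(E_j)=l(E_j)$ for $j\neq i$. If $e$ connects two distinct components, say $E_1$ and $E_2$, then $l_e(E_1\cup E_2\cup\{e\})=l(E_1)+l(E_2)$ and $l_e(E_j)=l(E_j)$ for $j>2$. The map $d$ satisfies $d^2=0$. *)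

(* Defs.v *)
From HB Require Import structures.
From mathcomp Require Import all_boot all_order all_algebra.
From mathcomp Require Import ring_quotient.
From mathcomp Require Import boolp classical_sets fsbigop.
From mathcomp Require Import freeg zify.

Set Implicit Arguments.
Unset Strict Implicit.
Unset Printing Implicit Defensive.

Import Order.TTheory GRing.Theory Num.Theory.

Local Open Scope ring_scope.

(* Loops are the edges with equal ends; parallel edges are distinct elements
   of [edge] with the same ends. Edges are not oriented: the order in which
   the two ends of an edge are listed is irrelevant to everything below. *)
Record multigraph := Multigraph {
  vertex : finType;
  edge : finType;
  ends : edge -> vertex * vertex
}.

Section Components.
Variable G : multigraph.
Implicit Types (s : {set edge G}) (x y : vertex G).

(* adjacency in [G:s] *)
Definition adjacent s : rel (vertex G) := fun x y =>
  [exists e in s, (ends e == (x, y)) || (ends e == (y, x))].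

(* A connected component is identified with its set of vertices. *)
Definition component s x : {set vertex G} :=
  [set y | connect (adjacent s) x y].

Definition components s : {set {set vertex G}} :=
  [set component s x | x : vertex G].

Definition ncomponents s : nat := #|components s|.

End Components.

Section EnhancedStates.
Variable G : multigraph.
Implicit Types (s : {set edge G}) (e : edge G).

Definition labeling s := {ffun {E | E \in components s} -> nat}.

Definition enhanced_state := {s : {set edge G} & labeling s}.

Definition label_sum s (l : labeling s) : nat := \sum_E l E.

Definition ideg (S : enhanced_state) : nat := #|tag S|.

Definition jdeg (S : enhanced_state) : int :=
  #|tag S|%:Z + (ncomponents (tag S))%:Z - (label_sum (tagged S))%:Z.

(* the label of the component E; 0 if E is not a component of [G:s] *)
Definition label_of s (l : labeling s) (E : {set vertex G}) : nat :=
  if insub E is Some E' then l E' else 0%N.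

Definition add_edge_labeling s (l : labeling s) e : labeling (e |: s) :=
  let E1 := component s (ends e).1 in
  let E2 := component s (ends e).2 in
  [ffun E => if E1 == E2 then
               if val E == E1 then (label_of l E1).+1 else label_of l (val E)
             else
               if val E == E1 :|: E2 then (label_of l E1 + label_of l E2)%N
               else label_of l (val E)].

Definition add_edge (S : enhanced_state) e : enhanced_state :=
  Tagged labeling (add_edge_labeling (tagged S) e).

End EnhancedStates.

(* the free abelian group on all enhanced states, of all bidegrees *)
Notation chain G := {freeg (enhanced_state G) / int}.

Section Complex.
Variable G : multigraph.

(* C^{i,j}, as a subgroup of [chain G] *)
Definition chain_group (i : nat) (j : int) : {pred chain G} :=
  [pred x : chain G | all (fun S => (ideg S == i) && (jdeg S == j)) (dom x)].

Lemma chain_groupP i j (x : chain G) :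
  reflect (forall S, coeff S x != 0 -> ideg S = i /\ jdeg S = j)
          (x \in chain_group i j).
Proof.
apply: (iffP allP) => [h S nz|h S].
  by move: (h S); rewrite mem_dom => /(_ nz) /andP[/eqP -> /eqP ->].
by rewrite mem_dom => /h [-> ->]; rewrite !eqxx.
Qed.

Lemma chain_group_zmod i j : zmod_closed (chain_group i j).
Proof.
split=> [|x y /chain_groupP hx /chain_groupP hy].
  by apply/chain_groupP => S; rewrite coeff0 eqxx.
apply/chain_groupP => S; rewrite coeffB => nz.
have [x0|/hx //] := eqVneq (coeff S x) 0.
by apply: hy; apply: contra_neq nz => ->; rewrite x0 subr0.
Qed.

(* the total order on the edges that fixes the signs of the differential *)
Variable le : rel (edge G).

Definition edges_before (s : {set edge G}) (e : edge G) : nat :=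
  #|[set f in s | le f e && (f != e)]|.

Definition differential_state (S : enhanced_state G) : chain G :=
  \sum_(e | e \notin tag S) << (-1) ^+ edges_before (tag S) e *g add_edge S e >>.

Definition differential : chain G -> chain G := fglift differential_state.

Lemma differentialB : {morph differential : x y / x - y}.
Proof. exact: lift_is_additive. Qed.

Lemma differential0 : differential 0 = 0.
Proof. by rewrite -{1}(subrr 0) differentialB subrr. Qed.

Definition is_cycle i j : {pred chain G} :=
  [pred x : chain G | (x \in chain_group i j) && (differential x == 0)].

Lemma is_cycle_zmod i j : zmod_closed (is_cycle i j).
Proof.
have [c0 cB] := chain_group_zmod i j.
split=> [|x y /andP[xC /eqP dx] /andP[yC /eqP dy]]; apply/andP; split=> //=.
- by rewrite differential0.
- exact: cB.
- by rewrite differentialB dx dy subrr.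
Qed.

HB.instance Definition _ i j :=
  GRing.isZmodClosed.Build (chain G) (is_cycle i j) (is_cycle_zmod i j).

Record cycle i j := Cycle { cycle_val : chain G; _ : cycle_val \in is_cycle i j }.

HB.instance Definition _ i j := [isSub for @cycle_val i j].
HB.instance Definition _ i j := [Choice of cycle i j by <:].
HB.instance Definition _ i j := [SubChoice_isSubZmodule of cycle i j by <:].

(* the image of C^{i-1,j}, where C^{-1,j} = 0 *)
Definition boundary (i : nat) (j : int) (x : chain G) : Prop :=
  match i with
  | 0 => x = 0
  | i'.+1 => exists2 y : chain G, y \in chain_group i' j & x = differential y
  end.

Definition is_boundary i j : {pred cycle i j} :=
  [pred x : cycle i j | `[< boundary i j (cycle_val x) >]].

Lemma is_boundary_zmod i j : zmod_closed (@is_boundary i j).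
Proof.
split=> [|x y /asboolP bx /asboolP by_]; apply/asboolP.
  case: i => [|i] //; exists 0; last by rewrite differential0.
  by have [] := chain_group_zmod i j.
case: i x y bx by_ => [|i] x y /=; first by move=> -> ->; rewrite subrr.
move=> [x' x'C ->] [y' y'C ->]; exists (x' - y'); last by rewrite differentialB.
by have [_] := chain_group_zmod i j; apply.
Qed.

HB.instance Definition _ i j :=
  GRing.isZmodClosed.Build (cycle i j) (@is_boundary i j) (is_boundary_zmod i j).

(* H^{i,j}, the part of degree j of the i-th homology group: the quotient of the
   cycles in C^{i,j} by those that are boundaries (all boundaries are cycles,
   because the differential squares to 0 and preserves j). *)
Definition homology (i : nat) (j : int) : zmodType := Quotient.quot (@is_boundary i j).

End Complex.

Section Rank.

Definition biadditive (M N U : zmodType) (f : M -> N -> U) : Prop :=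
  (forall n, {morph f^~ n : x y / x + y}) /\
  (forall m, {morph f m : x y / x + y}).

(* T, together with t, is the tensor product of M and N over the integers. *)
Definition is_tensor_product (M N T : zmodType) (t : M -> N -> T) : Prop :=
  biadditive t /\
  forall (U : zmodType) (f : M -> N -> U), biadditive f ->
    exists g : {additive T -> U}, (forall m n, g (t m n) = f m n) /\
      forall g' : {additive T -> U}, (forall m n, g' (t m n) = f m n) -> g' =1 g.

(* M (x) Q has dimension r over Q, where Q acts on the second factor. *)
Definition has_rank (M : zmodType) (r : nat) : Prop :=
  exists (W : vectType rat) (t : M -> rat -> W),
    [/\ is_tensor_product t, forall a m b, t m (a * b) = a *: t m b
      & \dim {: W} = r].

End Rank.

(* A series in q with integer exponents, infinitely many of which may be
   negative, is the function giving the coefficient of q^n for each n. *)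
Definition series := int -> int.

Definition has_qdim (M : int -> zmodType) (D : series) : Prop :=
  forall k, exists2 r, has_rank (M k) r & D k = r%:Z.

(* H i j is the part of degree j of the homology group in position i. *)
Definition has_graded_euler_characteristic
    (m : nat) (H : nat -> int -> zmodType) (chi : series) : Prop :=
  exists D : nat -> series,
    (forall i, (i <= m)%N -> has_qdim (H i) (D i)) /\
    (forall k, chi k = \sum_(0 <= i < m.+1) (-1) ^+ i * D i k).

(* The coefficients are polynomials in q and the main variable is v. *)
Definition dichromatic (G : multigraph) : {poly {poly int}} :=
  \sum_(s : {set edge G}) ((-1) ^+ #|s| * 'X^#|s|)%:P * 'X^(ncomponents s).

Definition q_power (k : int) : series := fun n => if n == k then 1 else 0.

(* The Cauchy product. The sum is finite whenever the exponents occurring in f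
   and in g are bounded above, as in every use below. *)
Definition series_mul (f g : series) : series :=
  fun n => \sum_(a \in [set: int]) f a * g (n - a).

Definition series_exp (f : series) (k : nat) : series :=
  iter k (series_mul f) (q_power 0).

(* P(q, f) *)
Definition series_eval (P : {poly {poly int}}) (f : series) : series :=
  fun n => \sum_(b < size P) \sum_(a < size P`_b)
    P`_b`_a * series_mul (q_power a%:Z) (series_exp f b) n.

(* q^2 / (q - 1), expanded as the sum of q^(1 - i) over i >= 0 *)
Definition v_series : series := fun n => if n <= 1 then 1 else 0.

Lemma v_seriesE n :
  series_mul (fun a => q_power 1 a - q_power 0 a) v_series n = q_power 2 n.
Proof.
rewrite /series_mul -(fsbig_widen [set 0; 1]%classic setT) //=; last first.
  move=> a [_ /= na]; rewrite /q_power.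
  have [a1|_] := eqVneq a 1; first by case: na; right.
  have [a0|_] := eqVneq a 0; first by case: na; left.
  by rewrite subrr mul0r.
rewrite fsbigU0 //=; last by move=> a [/= ->].
rewrite !fsbig_set1 /q_power /v_series.
by rewrite /=; do ![case: ifP => ?]; lia.
Qed.

Definition J (G : multigraph) : series := series_eval (dichromatic G) v_series.

(* Main.v *)
From HB Require Import structures.
Require Import Defs.
From mathcomp Require Import boolp classical_sets fsbigop.
From mathcomp Require Import all_boot all_order all_algebra.
From mathcomp Require Import ring_quotient freeg zify ring.

(** The Euler characteristic of a complex can be computed on its chain groups,
provided that these have finite rank and that the differential preserves the
grading and squares to zero; the alternating sum of the chain groups is then
a count of enhanced states, and this count is the dichromatic polynomial.

The two properties of the differential are consequences of one conservation
law, [label_in_add_edge]: inside any vertex set that is closed for the enlarged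
graph, adding an edge raises by one the sum of the labels minus the number of
components. On the whole vertex set it says that [j] is preserved
([jdeg_add_edge]). On a component of the graph enlarged by two edges it computes
the final label by an expression symmetric in the two edges, so that adding
edges commutes ([add_edgeC]); the signs then make the squared differential
vanish ([differentialK]).

In a fixed degree [j] there are finitely many enhanced states in each position,
and the integral chains are a full lattice in a finite-dimensional rational
complex with the same matrices. A map to a rational vector space with torsion
kernel and cokernel exhibits that space as the tensor product with the
rationals ([has_rank_lattice]), so the rank of homology is the difference of the
dimensions of the rational cycles and boundaries ([has_rank_homology]).
Rank-nullity makes the alternating sum telescope ([euler_telescope]).

It remains to count. For an edge set [s] with [k] components, a labeling has
[j = |s| + k - |l|], so the generating function of the labelings of [s] is
[q^|s|] times the [k]th power of the sum of the [q^(1 - a)] over all labels [a],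
that is [q^|s| v^k] ([size_states]). Summing over [s] with signs gives the state
sum of the dichromatic polynomial ([J_sum]). *)

Set Implicit Arguments.
Unset Strict Implicit.
Unset Printing Implicit Defensive.

(** * Connected components after adding an edge *)

Section ComponentsTheory.
Variable G : multigraph.
Implicit Types (s : {set edge G}) (e : edge G) (x y : vertex G)
  (A E F : {set vertex G}).

Lemma adjacent_sym s : symmetric (adjacent s).
Proof.
by move=> x y; apply/existsP/existsP=> -[e he]; exists e; rewrite orbC.
Qed.

Lemma connect_adjacent_sym s : connect_sym (adjacent s).
Proof. exact/sym_connect_sym/adjacent_sym. Qed.

Lemma mem_component s x : x \in component s x.
Proof. by rewrite inE connect0. Qed.

Lemma eq_component s x y :
  (component s x == component s y) = connect (adjacent s) x y.
Proof.
apply/eqP/idP => [eq_xy|xy]; first by have := mem_component s y; rewrite -eq_xy inE.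
by apply/setP => z; rewrite !inE (same_connect (connect_adjacent_sym s) xy).
Qed.

Lemma mem_components s x : component s x \in components s.
Proof. exact: imset_f. Qed.

Lemma component_of_mem s E x : E \in components s -> x \in E -> component s x = E.
Proof.
by case/imsetP=> y _ ->; rewrite inE -eq_component => /eqP.
Qed.

Lemma sub_component_closed s A x :
  closed (adjacent s) A -> (component s x \subset A) = (x \in A).
Proof.
move=> clA; apply/subsetP/idP => [|xA y]; first by apply; exact: mem_component.
by rewrite inE => /(closed_connect clA) <-.
Qed.

Lemma component_closed s x : closed (adjacent s) (component s x).
Proof.
move=> y z yz; rewrite !inE; apply/idP/idP => h; apply: connect_trans h _.
  exact: connect1.
by rewrite connect_adjacent_sym connect1.
Qed.

Lemma sub_adjacent s s' : s \subset s' -> subrel (adjacent s) (adjacent s').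
Proof.
move=> /subsetP ss' x y /exists_inP[e es he].
by apply/exists_inP; exists e => //; apply: ss'.
Qed.

Lemma closed_sub_edges s s' A :
  s \subset s' -> closed (adjacent s') A -> closed (adjacent s) A.
Proof. by move=> ss' clA x y /(sub_adjacent ss'); apply: clA. Qed.

Lemma adjacent_add_edge s e x y : adjacent (e |: s) x y =
  adjacent s x y || (ends e == (x, y)) || (ends e == (y, x)).
Proof.
rewrite -orbA; apply/exists_inP/orP => [[f /setU1P[->|fs]]|[|]].
- by right.
- by left; apply/exists_inP; exists f.
- by case/exists_inP=> f fs he; exists f => //; rewrite setU1r.
- by exists e => //; rewrite setU11.
Qed.

(** For a bridge this merges two classes; for an edge closing a cycle [U] is
a single class and nothing changes. Stating both cases at once is what lets
[component_add_edge] be a single formula. *)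
Lemma connect_add_edge s e x y
    (U := component s (ends e).1 :|: component s (ends e).2) :
  connect (adjacent (e |: s)) x y =
  connect (adjacent s) x y || (x \in U) && (y \in U).
Proof.
have sub_s := sub_adjacent (subsetU1 e s).
have sub_c : subrel (connect (adjacent s)) (connect (adjacent (e |: s))).
  by apply: connect_sub => u v uv; apply/connect1/sub_s.
have csym := connect_adjacent_sym (e |: s).
apply/idP/idP; last first.
  case/orP=> [/sub_c //|/andP[xU yU]].
  have fromU u : u \in U -> connect (adjacent (e |: s)) (ends e).1 u.
    case/setUP; rewrite inE => /sub_c // h; apply: connect_trans h.
    by apply: connect1; rewrite adjacent_add_edge -surjective_pairing eqxx orbT.
  by apply: connect_trans (fromU _ yU); rewrite csym fromU.
have UE u v : connect (adjacent s) u v -> (u \in U) = (v \in U).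
  by move=> uv; rewrite !inE !(same_connect_r (connect_adjacent_sym s) uv).
case/connectP=> p; elim: p x => [|z p IHp] x /=; first by move=> _ ->; rewrite connect0.
case/andP=> xz /IHp{}IHp /IHp.
have : connect (adjacent s) x z || (x \in U) && (z \in U).
  move: xz; rewrite adjacent_add_edge -orbA => /orP[/connect1->//|].
  by case/orP=> /eqP he; rewrite /U he /= !inE !connect0 ?orbT.
case/orP=> [xz'|/andP[xU zU]].
  case/orP=> [zy|]; first by rewrite (connect_trans xz' zy).
  by rewrite (UE _ _ xz') => ->; rewrite orbT.
by case/orP=> [/UE <-|/andP[_ ->]]; rewrite xU ?zU orbT.
Qed.

Lemma component_add_edge s e x
    (U := component s (ends e).1 :|: component s (ends e).2) :
  component (e |: s) x = if x \in U then U else component s x.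
Proof.
apply/setP => y; rewrite inE connect_add_edge.
have [xU|xU] := ifPn; last by rewrite orbF inE.
rewrite /= orb_idl // => xy; move: xU.
by rewrite !inE !(same_connect_r (connect_adjacent_sym s) xy).
Qed.

Lemma components_add_cycle s e :
  component s (ends e).1 = component s (ends e).2 ->
  components (e |: s) = components s.
Proof.
move=> e12; apply: eq_imset => x; rewrite component_add_edge -e12 setUid.
by case: ifP => // /component_of_mem -> //; apply: mem_components.
Qed.

Lemma components_add_bridge s e (E1 := component s (ends e).1)
    (E2 := component s (ends e).2) :
  components (e |: s) = (E1 :|: E2) |: (components s :\ E1 :\ E2).
Proof.
have s1 : E1 \in components s by exact: mem_components.
have s2 : E2 \in components s by exact: mem_components.
apply/setP=> F; rewrite !inE; apply/imsetP/idP => [[x _ ->]|].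
  rewrite component_add_edge; have [xU|xU] := ifPn; first by rewrite eqxx.
  rewrite mem_components andbT; apply/orP; right.
  by apply/andP; split; apply: contraNneq xU; rewrite /E1 /E2 => <-;
    rewrite inE mem_component ?orbT.
case/orP=> [/eqP ->|/and3P[F2 F1 /imsetP[x _ Fx]]].
  by exists (ends e).1 => //; rewrite component_add_edge inE mem_component.
exists x => //; rewrite component_add_edge ifN // inE negb_or.
apply/andP; split; [apply: contra F1 | apply: contra F2] => /component_of_mem h.
  by rewrite Fx h.
by rewrite Fx h.
Qed.

(** The two sums differ only in that the merged component replaces [E1] and
[E2], so that they can be compared through the common remainder [r]. *)
Lemma sum_components_bridge s e A (E1 := component s (ends e).1)
    (E2 := component s (ends e).2) (g : {set vertex G} -> nat) :
  E1 != E2 -> (ends e).1 \in A -> closed (adjacent (e |: s)) A ->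
  let r := \sum_(F in components s :\ E1 :\ E2 | F \subset A) g F in
  \sum_(F in components s | F \subset A) g F = g E1 + g E2 + r /\
  \sum_(F in components (e |: s) | F \subset A) g F = g (E1 :|: E2) + r.
Proof.
move=> neq12 e1A clA r.
have clsA := closed_sub_edges (subsetU1 e s) clA.
have e2A : (ends e).2 \in A.
  by rewrite -(clA (ends e).1) // adjacent_add_edge -surjective_pairing eqxx orbT.
have s1 : E1 \in components s by exact: mem_components.
have s2 : E2 \in components s by exact: mem_components.
have A1 : E1 \subset A by rewrite sub_component_closed.
have A2 : E2 \subset A by rewrite sub_component_closed.
split.
  rewrite (bigD1 E1) ?s1 // (bigD1 E2) ?s2 ?A2 1?eq_sym //= addnA; congr (_ + _).
  by apply: eq_bigl => F; rewrite !inE; case: (F \in _); case: (F \subset A);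
     case: (F == E1); case: (F == E2).
rewrite (bigD1 (E1 :|: E2)); last by rewrite components_add_bridge setU11 subUset A1.
congr (_ + _); apply: eq_bigl => F; rewrite components_add_bridge !inE.
case: eqVneq => [->|_] /=; last by rewrite andbT.
rewrite andbF; apply/esym/negbTE; apply/negP=> /andP[/and3P[U2 U1 Us] _].
have e1U : (ends e).1 \in E1 :|: E2 by rewrite inE mem_component.
by move: U1; rewrite -(component_of_mem Us e1U) eqxx.
Qed.

Lemma sum_components_far s e A (g : {set vertex G} -> nat) :
  (ends e).1 \notin A -> closed (adjacent (e |: s)) A ->
  \sum_(F in components (e |: s) | F \subset A) g F =
  \sum_(F in components s | F \subset A) g F.
Proof.
move=> e1A clA.
have e2A : (ends e).2 \notin A.
  by rewrite -(clA (ends e).1) // adjacent_add_edge -surjective_pairing eqxx orbT.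
apply: eq_bigl => F; rewrite components_add_bridge !inE.
case FA: (F \subset A); rewrite ?andbF ?andbT //.
have off x : x \notin A -> F != component s x.
  by apply: contraNneq => Fx; apply: (subsetP FA); rewrite Fx mem_component.
rewrite !off //= orb_idl // => /eqP FU.
by case/negP: e1A; apply: (subsetP FA); rewrite FU inE mem_component.
Qed.

End ComponentsTheory.

(** * Labels inside a closed set of vertices *)

Section Labels.
Variable G : multigraph.
Implicit Types (s : {set edge G}) (e : edge G) (x y : vertex G)
  (A E F : {set vertex G}) (S T : enhanced_state G).

Definition ncomponents_in s A := #|[set F in components s | F \subset A]|.

Definition label_in S A :=
  \sum_(F in components (tag S) | F \subset A) label_of (tagged S) F.

Lemma label_ofE s (l : labeling s) (E : {E | E \in components s}) :
  label_of l (val E) = l E.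
Proof. by rewrite /label_of valK. Qed.

Lemma label_in_setT S : label_in S setT = label_sum (tagged S).
Proof.
rewrite /label_in /label_sum.
rewrite (eq_bigl [in components (tag S)]); last by move=> F; rewrite subsetT andbT.
by rewrite big_sub; apply: eq_bigr => E _; rewrite label_ofE.
Qed.

Lemma enhanced_state_ext S T : tag S = tag T ->
  {in components (tag S), label_of (tagged S) =1 label_of (tagged T)} -> S = T.
Proof.
case: S T => s l [t k] /= st; rewrite -st in k * => eq_lk.
congr (existT _ _ _); apply/ffunP => E.
by rewrite -!label_ofE eq_lk // (valP E).
Qed.

Lemma ncomponents_inE s A :
  ncomponents_in s A = \sum_(F in components s | F \subset A) 1.
Proof.
rewrite /ncomponents_in -sum1_card.
by apply: eq_bigl => F; rewrite inE.
Qed.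

Lemma label_of_add_edge s (l : labeling s) e F (E1 := component s (ends e).1)
    (E2 := component s (ends e).2) : F \in components (e |: s) ->
  label_of (add_edge_labeling l e) F =
    if E1 == E2 then (F == E1) + label_of l F
    else if F == E1 :|: E2 then label_of l E1 + label_of l E2 else label_of l F.
Proof.
move=> Fs; rewrite {1}/label_of insubT ffunE /=.
rewrite -/E1 -/E2; case: (E1 == E2) => //.
by case: eqP => [->|].
Qed.

(** The conservation law behind the degree and commutation properties of the
differential. On a bridge the labels inside [A] keep their sum while one
component of [A] is lost; on an edge closing a cycle a label grows by one while
the number of components stays. Hence the sum of the labels minus the number
of components grows by exactly one in both cases, if the edge lies in [A]. It
is stated without subtraction. *)
Lemma label_in_add_edge S e A : closed (adjacent (e |: tag S)) A ->
  label_in (add_edge S e) A + ncomponents_in (tag S) A =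
  label_in S A + ((ends e).1 \in A) + ncomponents_in (e |: tag S) A.
Proof.
case: S => s l /= clA; rewrite /label_in /= !ncomponents_inE.
have clsA := closed_sub_edges (subsetU1 e s) clA.
under eq_bigr => F /andP[Fs _] do rewrite label_of_add_edge //.
have [e12|ne12] := eqVneq.
  rewrite components_add_cycle //; congr (_ + _); rewrite big_split /= addnC.
  congr (_ + _); rewrite -(sub_component_closed _ clsA).
  have [E1A|E1A] := boolP (component s (ends e).1 \subset A).
    rewrite (bigD1 (component s (ends e).1)) /=; last by rewrite mem_components.
    by rewrite eqxx big1 // => F /andP[_ /negbTE ->].
  rewrite big1 // => F /andP[_ FA].
  by case: eqP FA E1A => // -> ->.
have [e1A|e1A] := boolP ((ends e).1 \in A); last first.
  rewrite !sum_components_far // addn0; congr (_ + _).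
  apply: eq_bigr => F /andP[_ FA]; case: eqP FA => // ->.
  by rewrite subUset sub_component_closed // (negbTE e1A).
have [sum_l _] := sum_components_bridge (label_of l) ne12 e1A clA.
have [sum_1s sum_1es] := sum_components_bridge (fun=> 1) ne12 e1A clA.
have [_ ->] := sum_components_bridge (fun F => if F ==
   component s (ends e).1 :|: component s (ends e).2 then
   label_of l (component s (ends e).1) + label_of l (component s (ends e).2)
   else label_of l F) ne12 e1A clA.
rewrite sum_l sum_1s sum_1es eqxx.
set r := \sum_(F in _ | _) (if _ then _ else _).
suff -> : r = \sum_(F in components s :\ component s (ends e).1 :\
              component s (ends e).2 | F \subset A) label_of l F by lia.
apply: eq_bigr => F /andP[+ _]; rewrite !inE => /and3P[_ F1 Fs].
case: eqP => // FU; case/negP: F1; rewrite -(component_of_mem Fs (x := (ends e).1)) //.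
by rewrite FU inE mem_component.
Qed.

Lemma label_in_component s (l : labeling s) E : E \in components s ->
  label_in (Tagged (@labeling G) l) E = label_of l E.
Proof.
move=> Es; rewrite /label_in (bigD1 E) /= ?Es ?subxx // big1 ?addn0 // => F.
case/andP=> /andP[/imsetP[x _ ->] FE]; case/eqP.
by apply: component_of_mem Es _; apply: (subsetP FE); exact: mem_component.
Qed.

(** A component of the final graph is closed for all the intermediate graphs,
so the label it carries is determined by [label_in_add_edge] applied twice: it
is the sum of the old labels inside, corrected by the numbers of components and
of added edges inside, in which [e] and [f] play symmetric roles. *)
Lemma add_edgeC S e f : add_edge (add_edge S e) f = add_edge (add_edge S f) e.
Proof.
apply: enhanced_state_ext => [|E /= Es]; first by rewrite /= setUCA.
have clE : closed (adjacent (f |: (e |: tag S))) E.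
  by case/imsetP: Es => x _ ->; exact: component_closed.
rewrite -!label_in_component //; last by rewrite setUCA.
have clE' := clE; rewrite setUCA in clE'.
have h1 := label_in_add_edge (S := add_edge S e) clE.
have h2 := label_in_add_edge (S := S) (closed_sub_edges (subsetU1 f _) clE).
have h3 := label_in_add_edge (S := add_edge S f) clE'.
have h4 := label_in_add_edge (S := S) (closed_sub_edges (subsetU1 e _) clE').
have h5 : ncomponents_in (f |: (e |: tag S)) E =
          ncomponents_in (e |: (f |: tag S)) E by rewrite setUCA.
by move: h1 h2 h3 h4; rewrite /= h5; rewrite /add_edge /=; lia.
Qed.

Lemma ncomponents_in_setT s : ncomponents_in s setT = ncomponents s.
Proof. by apply: eq_card => F; rewrite inE subsetT andbT. Qed.

Lemma ideg_add_edge S e : e \notin tag S -> ideg (add_edge S e) = (ideg S).+1.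
Proof. by move=> eS; rewrite /ideg cardsU1 eS. Qed.

(** The case of the whole vertex set in [label_in_add_edge]. *)
Lemma jdeg_add_edge S e : e \notin tag S -> jdeg (add_edge S e) = jdeg S.
Proof.
move=> eS; have clT : closed (adjacent (e |: tag S)) [set: vertex G].
  by move=> x y; rewrite !inE.
have := label_in_add_edge clT; have := ideg_add_edge eS.
rewrite !label_in_setT !ncomponents_in_setT inE /jdeg /ideg /=; lia.
Qed.

End Labels.

(** * The differential squares to zero and preserves the grading *)

Import Order.TTheory GRing.Theory Num.Theory.
Local Open Scope ring_scope.

Section Differential.
Variables (G : multigraph) (le : rel (edge G)).
Implicit Types (s : {set edge G}) (e f : edge G) (S T : enhanced_state G)
  (x y : chain G).

HB.instance Definition _ :=
  GRing.isZmodMorphism.Build _ _ (differential le) (differentialB le).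
HB.instance Definition _ i j :=
  GRing.isZmodClosed.Build (chain G) (chain_group i j) (@chain_group_zmod G i j).

Lemma differentialU (c : int) S :
  differential le << c *g S >> = c *: differential_state le S.
Proof. exact: liftU. Qed.

Lemma differential_sum x :
  differential le x = \sum_(S <- dom x) coeff S x *: differential_state le S.
Proof.
rewrite -{1}(freeg_sumE x) raddf_sum; apply: eq_bigr => S _.
exact: differentialU.
Qed.

Lemma chain_groupZ i j (c : int) x :
  x \in chain_group i j -> c *: x \in chain_group i j.
Proof.
move/chain_groupP => xC; apply/chain_groupP => S; rewrite coeffZ => nz.
by apply: xC; apply: contra_neq nz => ->; rewrite mulr0.
Qed.

Lemma chain_groupU i j (c : int) S :
  ideg S = i -> jdeg S = j -> << c *g S >> \in chain_group i j.
Proof.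
move=> iS jS; apply/chain_groupP => T; rewrite coeffU.
by case: (eqVneq S T) => [<- //|_]; rewrite mulr0 eqxx.
Qed.

Lemma differential_chain_group i j x :
  x \in chain_group i j -> differential le x \in chain_group i.+1 j.
Proof.
move=> /chain_groupP xC; rewrite differential_sum big_seq rpred_sum // => S.
rewrite mem_dom => /xC[iS jS]; apply/chain_groupZ/rpred_sum => e eS.
by apply: chain_groupU; rewrite ?ideg_add_edge ?jdeg_add_edge ?iS.
Qed.

Lemma edges_before_add_edge s e f : e \notin s ->
  edges_before le (e |: s) f = (edges_before le s f + (le e f && (e != f)))%N.
Proof.
move=> es; rewrite /edges_before.
have [ef|ef] := boolP (le e f && (e != f)).
  rewrite addn1 -add1n -[in RHS](cards1 e) -cardsUI addnC.
  rewrite [X in (X + _)%N](_ : _ = 0%N); last first.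
    apply: eq_card0 => g; rewrite !inE.
    by case: eqP => // ->; rewrite (negbTE es).
  apply: eq_card => g; rewrite !inE.
  by case: eqP => // ->; rewrite ef.
rewrite addn0; apply: eq_card => g; rewrite !inE.
by case: eqP => // ->; rewrite (negbTE ef) (negbTE es).
Qed.

Lemma differential_add_edge_sum S : differential le (differential_state le S) =
  \sum_e \sum_(f | [&& e != f, e \notin tag S & f \notin tag S])
    << (-1) ^+ (edges_before le (tag S) e + edges_before le (e |: tag S) f)
       *g add_edge (add_edge S e) f >>.
Proof.
rewrite raddf_sum big_mkcond; apply: eq_bigr => e _ /=.
case: ifP => eS; last by rewrite big_pred0 // => f; rewrite andbF.
rewrite differentialU scaler_sumr; apply: eq_big => [f|f _].
  by rewrite in_setU1 negb_or eq_sym.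
by apply/eqP/freeg_eqP => T; rewrite coeffZ !coeffU mulrA -exprD.
Qed.

Hypotheses (le_anti : antisymmetric le) (le_total : total le).

(** Adding [e] then [f] and adding [f] then [e] give the same state, and exactly
one of the two orders counts one more edge before the second one added, so the
double sum is its own opposite after exchanging the summation variables. *)
Lemma differential_stateK S : differential le (differential_state le S) = 0.
Proof.
set X := LHS; suff XN : X = - X.
  apply/eqP/freeg_eqP => T; rewrite coeff0.
  have := congr1 (coeff T) XN; rewrite coeffN; lia.
rewrite {1}/X differential_add_edge_sum (exchange_big_dep xpredT) //= /X.
rewrite differential_add_edge_sum -sumrN; apply: eq_bigr => e _.
rewrite -sumrN; apply: eq_big => [f|f /and3P[ef eS fS]].
  by rewrite eq_sym; congr andb; rewrite andbC.
rewrite add_edgeC !edges_before_add_edge // [e == f]eq_sym ef !andbT.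
have -> : le f e = ~~ le e f.
  have := le_total e f; have := @le_anti e f.
  case: (le e f) => /=; case: (le f e) => //= /(_ isT) fe.
  by rewrite fe eqxx in ef.
rewrite freegUN addnCA; congr (Freeg [:: (_, _)]).
case: (le e f); rewrite /= ?addn0 ?addn1 ?addnS ?exprS ?mulN1r ?opprK addnC //.
Qed.

Lemma differentialK x : differential le (differential le x) = 0.
Proof.
rewrite (differential_sum x) raddf_sum big1 // => S _.
by rewrite -(intz (coeff S x)) scaler_int raddfMz /= differential_stateK mul0rz.
Qed.

End Differential.

(** * Ranks of abelian groups through rational vector spaces *)

Section RationalRank.

Lemma biadditive_Mn (M N U : zmodType) (f : M -> N -> U) n x y :
  biadditive f -> f (x *+ n) y = f x (y *+ n).
Proof.
case=> fl fr; have f0 m : f m 0 = 0 by apply: (addrI (f m 0)); rewrite -fr !addr0.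
have f0' m : f 0 m = 0 by apply: (addrI (f 0 m)); rewrite -fl !addr0.
elim: n => [|n IHn]; first by rewrite !mulr0n f0 f0'.
by rewrite !mulrS fl fr IHn.
Qed.

Lemma biadditive0 (M N U : zmodType) (f : M -> N -> U) y :
  biadditive f -> f 0 y = 0.
Proof. by case=> fl _; apply: (addrI (f 0 y)); rewrite -fl !addr0. Qed.

Lemma biadditiveMz (M N U : zmodType) (f : M -> N -> U) (n : int) x y :
  biadditive f -> f (x *~ n) y = f x (y *~ n).
Proof.
move=> bf.
have fN u v : f (- u) v = - f u v.
  by apply: (addrI (f u v)); rewrite -(proj1 bf) !subrr biadditive0.
have fN' u v : f u (- v) = - f u v.
  apply: (addrI (f u v)); rewrite -(proj2 bf) !subrr.
  by rewrite -[0]/(0 *+ 0) -(biadditive_Mn 0 u 0 bf) mulr0n biadditive0.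
case: n => n; first by rewrite -!pmulrn (biadditive_Mn _ _ _ bf).
by rewrite NegzE -!nmulrn fN fN' (biadditive_Mn _ _ _ bf).
Qed.

Lemma rat_frac (a : rat) : exists (p : int) (N : nat), (0 < N)%N /\ a = p%:~R / N%:R.
Proof.
exists (numq a), `|denq a|%N; split; first by rewrite absz_gt0 denq_neq0.
have -> : `|denq a|%N%:R = (denq a)%:~R :> rat by rewrite -[in RHS]absz_denq pmulrn.
by rewrite divq_num_den.
Qed.

Lemma natr_neq0 (n : nat) : (0 < n)%N -> n%:R != 0 :> rat.
Proof. by move=> n0; rewrite pnatr_eq0 -lt0n. Qed.

(** A map from [M] to a rational vector space with torsion kernel and torsion
cokernel becomes an isomorphism after tensoring with the rationals. For the
universal property, a vector [w] with [w *+ n = phi m] must go to [f m n^-1];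
this does not depend on [m] and [n] because the second argument of [f] can be
divided, so that [f] vanishes on torsion. *)
Lemma has_rank_lattice (M : zmodType) (W : vectType rat) (phi : {additive M -> W}) :
    (forall m, phi m = 0 -> exists2 n, (0 < n)%N & m *+ n = 0) ->
    (forall w, exists2 n, (0 < n)%N & exists m, w *+ n = phi m) ->
  has_rank M (\dim {: W}).
Proof.
move=> ker_phi coker_phi.
exists W, (fun m a => a *: phi m); split=> //; last by move=> m a b; rewrite scalerA.
split.
  split=> [a x y|m a b]; first by rewrite raddfD scalerDr.
  by rewrite scalerDl.
move=> U f bf; have [fl fr] := bf.
have torsion0 m a : phi m = 0 -> f m a = 0.
  case/ker_phi=> n n0 mn; have -> : a = (a / n%:R) *+ n.
    by rewrite -mulr_natr divfK // natr_neq0.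
  by rewrite -(biadditive_Mn _ _ _ bf) mn biadditive0.
have f_phi m m' a : phi m = phi m' -> f m a = f m' a.
  move=> mm'; rewrite -[m](subrK m') fl torsion0 ?add0r //.
  by rewrite raddfB mm' subrr.
have /choice[r rP] : forall w, exists r : M * nat, (0 < r.2)%N /\ w *+ r.2 = phi r.1.
  by move=> w; have [n n0 [m e]] := coker_phi w; exists (m, n).
pose g w := f (r w).1 ((r w).2%:R^-1).
have gE w m n : (0 < n)%N -> w *+ n = phi m -> g w = f m n%:R^-1.
  move=> n0 wm; have [k0 wk] := rP w; rewrite /g; set k := (r w).2 in k0 wk *.
  have inv_split p q : (0 < p)%N -> (0 < q)%N -> p%:R^-1 = (p * q)%:R^-1 *+ q :> rat.
    by move=> p0 q0; rewrite -[RHS]mulr_natr natrM invfM divfK // natr_neq0.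
  rewrite (inv_split k n) // (inv_split n k) // -!(biadditive_Mn _ _ _ bf).
  by rewrite mulnC; apply: f_phi; rewrite !raddfMn -wk -wm -!mulrnA mulnC.
have gD w w' : g (w + w') = g w + g w'.
  have [n0 wn] := rP w; have [n'0 wn'] := rP w'.
  set m := (r w).1 in wn; set m' := (r w').1 in wn'.
  set n := (r w).2 in n0 wn; set n' := (r w').2 in n'0 wn'.
  have nn'0 : (0 < n * n')%N by rewrite muln_gt0 n0.
  have e : w *+ (n * n') = phi (m *+ n') by rewrite raddfMn -wn mulrnA.
  have e' : w' *+ (n * n') = phi (m' *+ n) by rewrite raddfMn -wn' mulnC mulrnA.
  rewrite (gE w _ _ nn'0 e) (gE w' _ _ nn'0 e') -fl.
  by apply: gE; rewrite // mulrnDl e e' raddfD.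
have gB : {morph g : w w' / w - w'}.
  by move=> w w'; apply: (addIr (g w')); rewrite -gD !subrK.
pose gM := GRing.isZmodMorphism.Build _ _ g gB.
pose g' : {additive W -> U} := HB.pack g gM.
exists g'; split=> [m a|h hP w] /=.
  have [p [N [N0 ->]]] := rat_frac a.
  rewrite (gE _ (m *~ p) N N0); last first.
    by rewrite scalerMnl -mulr_natr divfK ?natr_neq0 // scaler_int raddfMz.
  by rewrite (biadditiveMz _ _ _ bf) -mulrzl.
have [n0 wn] := rP w; rewrite /g -hP -wn.
by rewrite -scaler_nat scalerA mulVf ?natr_neq0 // scale1r.
Qed.

(** The hypotheses say that [psi] maps [Z] to [U] with torsion cokernel and that
[B] is, up to torsion, the preimage of [B0]. Composing [psi] with the projection
of [U] along [B0] then puts the quotient in the situation of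
[has_rank_lattice]. *)
Lemma has_rank_quotient (Z : zmodType) (B : zmodClosed Z) (V : vectType rat)
    (psi : {additive Z -> V}) (U B0 : {vspace V}) :
    (B0 <= U)%VS -> (forall z, psi z \in U) ->
    (forall u, u \in U -> exists2 n, (0 < n)%N & exists z, u *+ n = psi z) ->
    (forall z, z \in B -> psi z \in B0) ->
    (forall z, psi z \in B0 -> exists2 n, (0 < n)%N & z *+ n \in B) ->
  has_rank (Quotient.quot B) (\dim U - \dim B0).
Proof.
move=> B0U psiU U_psi psiB B_psi.
(* an endomorphism with kernel B0, which turns the quotient by B0 into an image *)
pose p : 'End(V) := (\1 - projv B0)%VF.
have pE v : p v = v - projv B0 v by rewrite !lfunE /= !lfunE.
have ker_p v : (p v == 0) = (v \in B0).
  rewrite pE subr_eq0; apply/eqP/idP => [->|vB0]; first exact: memv_proj.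
  by rewrite projv_id.
pose W := (p @: U)%VS.
have dimW : \dim {: subvs_of W} = (\dim U - \dim B0)%N.
  rewrite dimvf /dim /= -(limg_ker_dim p U) -/W.
  suff -> : (U :&: lker p)%VS = B0 by rewrite addKn.
  apply/vspaceP => v; rewrite memv_cap memv_ker ker_p andb_idl //.
  exact: (subvP B0U).
pose phi (q : Quotient.quot B) := vsproj W (p (psi (repr q))).
have phi_pi z : vsval (phi (\pi z)%qT) = p (psi z).
  rewrite vsprojK ?memv_img //; apply/eqP; rewrite -subr_eq0 -!raddfB /=.
  by rewrite ker_p psiB // Quotient.idealrBE reprK.
have phiB : {morph phi : x y / x - y}.
  move=> x y; apply: val_inj; rewrite -[x]reprK -[y]reprK -raddfB [RHS]raddfB /= !phi_pi.
  by rewrite !raddfB.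
rewrite -dimW.
pose phiM := GRing.isZmodMorphism.Build _ _ phi phiB.
pose Phi : {additive Quotient.quot B -> subvs_of W} := HB.pack phi phiM.
apply: (@has_rank_lattice _ _ Phi) => [m|w] /=.
  move=> /(congr1 vsval); rewrite -[m]reprK [LHS]phi_pi linear0 => /eqP.
  rewrite ker_p => /B_psi[n n0 zB]; exists n => //.
  rewrite -raddfMn -[RHS](raddf0 (\pi_(Quotient.quot B)%qT)); apply/eqP.
  by rewrite -Quotient.idealrBE subr0.
have /memv_imgP[u uU wu] := valP w.
have [n n0 [z uz]] := U_psi u uU; exists n => //; exists (\pi z)%qT.
by apply: val_inj; rewrite [RHS]phi_pi -uz raddfMn raddfMn /= wu.
Qed.

End RationalRank.

(** * The rational complex in a fixed degree *)

Section States.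
Variable G : multigraph.
Implicit Types (s : {set edge G}) (S : enhanced_state G).

(** With labels below a bound, enhanced states form a finite type. *)
Definition bounded_state B :=
  {s : {set edge G} & {ffun {E | E \in components s} -> 'I_B.+1}}.

Definition unbound B (x : bounded_state B) : enhanced_state G :=
  Tagged (@labeling G) [ffun E => (tagged x E : nat)].

Lemma unbound_inj B : injective (@unbound B).
Proof.
move=> [s l] [t k] eq_st; have /= st := congr1 tag eq_st.
case: t / st k eq_st => k /eqP; rewrite -tag_eqE /tag_eq eqxx /= tagged_asE.
move=> /eqP/ffunP lk; congr existT; apply/ffunP => E; apply: val_inj.
by have := lk E; rewrite !ffunE.
Qed.

(** In bidegree [(i, j)] the labels sum to [i + k - j], where the number [k] of
components is at most the number of vertices; this gives the bound. *)
Definition states i (j : int) : seq (enhanced_state G) :=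
  [seq unbound x | x <- enum [pred x : bounded_state (i + #|vertex G| + `|j|) |
     (ideg (unbound x) == i) && (jdeg (unbound x) == j)]].

Lemma states_uniq i j : uniq (states i j).
Proof. by rewrite map_inj_uniq ?enum_uniq //; apply: unbound_inj. Qed.

Lemma mem_states i j S : (S \in states i j) = (ideg S == i) && (jdeg S == j).
Proof.
apply/mapP/idP => [[x + ->]|/andP[/eqP iS /eqP jS]]; first by rewrite mem_enum.
case: S iS jS => s l iS jS.
have lB E : (l E < (i + #|vertex G| + `|j|).+1)%N.
  have : (l E <= label_sum l)%N by rewrite /label_sum (bigD1 E) //= leq_addr.
  have : (ncomponents s <= #|vertex G|)%N by rewrite leq_imset_card.
  move: jS; rewrite -iS /jdeg /ideg /=; lia.
pose x : bounded_state (i + #|vertex G| + `|j|) :=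
  Tagged (fun s => {ffun {E | E \in components s} -> 'I__})
    [ffun E => Ordinal (lB E)].
have xE : unbound x = Tagged (@labeling G) l.
  by congr existT; apply/ffunP => E; rewrite !ffunE.
by exists x => //; rewrite mem_enum inE xE iS jS !eqxx.
Qed.

End States.

Section RationalChains.
Variables (G : multigraph) (le : rel (edge G)) (j : int).
Hypotheses (le_anti : antisymmetric le) (le_total : total le).

Definition nstates i := size (states G i j).
Definition nth_state i (k : 'I_(nstates i)) := tnth (in_tuple (states G i j)) k.

Lemma nth_state_inj i : injective (@nth_state i).
Proof. exact/tuple_uniqP/states_uniq. Qed.

Definition coords i (x : chain G) : 'rV[rat]_(nstates i) :=
  \row_k (coeff (nth_state k) x)%:~R.

Definition rdiff_mx i : 'M[rat]_(nstates i, nstates i.+1) :=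
  \matrix_(k, l) (coeff (nth_state l) (differential_state le (nth_state k)))%:~R.

Definition rdiff i : 'Hom('rV[rat]_(nstates i), 'rV[rat]_(nstates i.+1)) :=
  linfun (mulmxr (rdiff_mx i)).

Lemma coords_is_zmod i : {morph (@coords i) : x y / x - y}.
Proof. by move=> x y; apply/rowP => k; rewrite !mxE coeffB rmorphB. Qed.

HB.instance Definition _ i :=
  GRing.isZmodMorphism.Build _ _ (@coords i) (@coords_is_zmod i).

Arguments coords : simpl never.

Lemma coords_inj i : {in chain_group i j &, injective (@coords i)}.
Proof.
move=> x y xC yC /rowP xy; apply/eqP; rewrite -subr_eq0; apply/eqP.
have /chain_groupP xyC : x - y \in chain_group i j by rewrite rpredB.
apply/eqP/freeg_eqP => S; rewrite coeff0; apply/eqP/negPn/negP => nz.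
have [iS jS] := xyC _ nz; move: nz; rewrite coeffB subr_eq0; case/eqP.
have /tnthP[k ->] : S \in in_tuple (states G i j) by rewrite mem_states iS jS !eqxx.
by have := xy k; rewrite !mxE => /intr_inj.
Qed.

(** Clearing denominators: the chains are a full lattice in the rational ones. *)
Lemma coords_lattice i (u : 'rV[rat]_(nstates i)) :
  exists2 n, (0 < n)%N & exists2 x, x \in chain_group i j & u *+ n = coords i x.
Proof.
have /fin_all_exists[r rP] k : exists r : int * nat,
  (0 < r.2)%N /\ u 0 k = r.1%:~R / r.2%:R.
  by have [p [N [N0 e]]] := rat_frac (u 0 k); exists (p, N).
pose n := (\prod_k (r k).2)%N; pose m k := (r k).1 * (\prod_(l | l != k) (r l).2)%N%:Z.
exists n; first by apply/prodn_gt0 => k; case: (rP k).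
exists (\sum_k << m k *g nth_state k >>).
  apply: rpred_sum => k _; have := mem_tnth k (in_tuple (states G i j)).
  by rewrite mem_states => /andP[/eqP iS /eqP jS]; apply: chain_groupU.
apply/rowP => k; rewrite mulmxnE mxE raddf_sum (bigD1 k) //= big1 ?addr0.
  have [k0 uk] := rP k; rewrite coeffU eqxx mulr1 uk /m /n (bigD1 k) //=.
  rewrite rmorphM /= mulrnA -[_ / _ *+ _]mulr_natr divfK ?natr_neq0 //.
  by rewrite -[LHS]mulr_natr.
move=> l lk; rewrite coeffU; case: eqP => [e|]; last by rewrite mulr0.
by case/eqP: lk; apply: nth_state_inj.
Qed.

Lemma chain_sum i x : x \in chain_group i j ->
  x = \sum_k << coeff (@nth_state i k) x *g nth_state k >>.
Proof.
move=> /chain_groupP xC; apply/eqP/freeg_eqP => T; rewrite raddf_sum /=.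
have [/(tnthP (in_tuple _))[k ->]|nT] := boolP (T \in states G i j).
  rewrite (bigD1 k) //= coeffU eqxx mulr1 big1 ?addr0 // => l lk.
  rewrite coeffU; case: eqP => [/nth_state_inj e|]; last by rewrite mulr0.
  by case/eqP: lk.
rewrite big1 => [|k _].
  by apply/eqP; apply: contraNT nT => /xC[iT jT]; rewrite mem_states iT jT !eqxx.
rewrite coeffU; case: eqP => [e|]; last by rewrite mulr0.
by case/negP: nT; rewrite -e mem_tnth.
Qed.

Lemma rdiff_coords i x : x \in chain_group i j ->
  rdiff i (coords i x) = coords i.+1 (differential le x).
Proof.
move=> xC; rewrite lfunE /=; apply/rowP => l; rewrite !mxE.
rewrite {2}(chain_sum xC) raddf_sum raddf_sum rmorph_sum; apply: eq_bigr => k _ /=.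
by rewrite differentialU coeffZ rmorphM !mxE.
Qed.

Lemma rdiffK i : (rdiff i.+1 \o rdiff i = 0)%VF.
Proof.
apply/lfunP => u; rewrite lfunE /= zero_lfunE.
have [n n0 [x xC un]] := coords_lattice u.
apply: (scalerI (natr_neq0 n0)); rewrite scaler0 !scaler_nat -!raddfMn /= un.
by rewrite !rdiff_coords ?differential_chain_group // differentialK // raddf0.
Qed.

Definition rboundary i : {vspace 'rV[rat]_(nstates i)} :=
  match i with 0 => 0%VS | i'.+1 => limg (rdiff i') end.

Definition hrank i := (\dim (lker (rdiff i)) - \dim (rboundary i))%N.

Lemma rboundary_sub i : (rboundary i <= lker (rdiff i))%VS.
Proof.
case: i => [|i] /=; first exact: sub0v.
apply/subvP => _ /memv_imgP[u _ ->]; rewrite memv_ker.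
by rewrite -[rdiff i.+1 _]comp_lfunE rdiffK lfunE.
Qed.

(** An integral chain that is a rational boundary need not be an integral one,
but some positive multiple of it is, and the rank does not see the difference. *)
Lemma has_rank_homology i : has_rank (homology le i j) (hrank i).
Proof.
pose psi (z : Defs.cycle le i j) := coords i (cycle_val z).
have psiB : {morph psi : x y / x - y} by move=> x y; rewrite /psi !raddfB.
pose psiM := GRing.isZmodMorphism.Build _ _ psi psiB.
pose Psi : {additive Defs.cycle le i j -> 'rV[rat]_(nstates i)} := HB.pack psi psiM.
apply: (@has_rank_quotient _ _ _ Psi).
- exact: rboundary_sub.
- move=> z; have /andP[zC /eqP dz] := valP z.
  by rewrite memv_ker /= /psi rdiff_coords // dz raddf0.
- move=> u; rewrite memv_ker => /eqP du; have [n n0 [x xC ux]] := coords_lattice u.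
  have xZ : x \in is_cycle le i j.
    rewrite inE /= xC; apply/eqP/(@coords_inj i.+1).
    + exact: differential_chain_group.
    + exact: rpred0.
    by rewrite -rdiff_coords // -ux raddfMn /= du mul0rn raddf0.
  by exists n => //; exists (Cycle xZ).
- move=> z /asboolP; rewrite /= /psi; case: i z {psi psiB psiM Psi} => [|i] z /=.
    by move=> ->; rewrite raddf0 mem0v.
  by case=> y yC ->; rewrite -rdiff_coords // memv_img ?memvf.
- move=> z; have zC n : cycle_val (z *+ n) \in chain_group i j.
    by have /andP[] := valP (z *+ n).
  have zM n : coords i (cycle_val (z *+ n)) = coords i (cycle_val z) *+ n.
    exact: (raddfMn Psi n z).
  have -> : Psi z = coords i (cycle_val z) by [].
  case: i z zC zM {psi psiB psiM Psi} => [|i] z zC zM.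
    rewrite memv0 => /eqP z0; exists 1%N => //; apply/asboolP => /=.
    by apply: (coords_inj (zC 1%N) (rpred0 _)); rewrite zM z0 mul0rn raddf0.
  case/memv_imgP=> u _ zu; have [n n0 [y yC uy]] := coords_lattice u.
  exists n => //; apply/asboolP; exists y => //.
  apply: (coords_inj (zC n) (differential_chain_group le yC)).
  by rewrite zM -rdiff_coords // -uy raddfMn /= zu.
Qed.

(** Rank-nullity splits each chain space into homology, incoming boundaries and
the cycles' complement, which is isomorphic to the boundaries one position
higher; these boundary terms cancel in the alternating sum. *)
Lemma euler_telescope m : nstates m.+1 = 0%N ->
  \sum_(0 <= i < m.+1) (-1) ^+ i * (hrank i)%:Z =
  \sum_(0 <= i < m.+1) (-1) ^+ i * (nstates i)%:Z.
Proof.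
move=> top0.
have dimC i : \dim {: 'rV[rat]_(nstates i)} = nstates i.
  by rewrite dimvf /dim /= mul1n.
have rank_nullity i : (nstates i = hrank i + \dim (rboundary i) + \dim (rboundary i.+1))%N.
  by rewrite subnK ?dimvS ?rboundary_sub // -{1}dimC -(limg_ker_dim (rdiff i) fullv) capfv.
have B0 : \dim (rboundary 0) = 0%N by rewrite dimv0.
have Bm : \dim (rboundary m.+1) = 0%N.
  apply/eqP; rewrite -leqn0; apply: leq_trans (dimvS (subvf _)) _.
  by rewrite dimC top0.
suff h k : \sum_(0 <= i < k) (-1) ^+ i * (nstates i)%:Z =
   \sum_(0 <= i < k) (-1) ^+ i * (hrank i)%:Z - (-1) ^+ k * (\dim (rboundary k))%:Z.
  by rewrite h Bm mulr0 subr0.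
elim: k => [|k IHk]; first by rewrite !big_geq // B0 mulr0 subr0.
rewrite !big_nat_recr //= IHk exprS.
have -> : (nstates k)%:Z =
    (hrank k)%:Z + (\dim (rboundary k))%:Z + (\dim (rboundary k.+1))%:Z.
  by have := rank_nullity k; lia.
by rewrite [rboundary k.+1]/=; ring.
Qed.

End RationalChains.

(** * Powers of the series v and the state sum *)

Section Series.

Definition geom B : {poly int} := \poly_(a < B.+1) 1.

(** Expanding the power into monomials, each labeling bounded by [B]
contributes one monomial, of degree the sum of its labels. *)
Lemma coef_geom_exp (T : finType) B t :
  (geom B ^+ #|T|)`_t =
  (#|[pred l : {ffun T -> 'I_B.+1} | (\sum_E l E)%N == t]|)%:Z.
Proof.
rewrite -prodr_const /geom poly_def.
under eq_bigr do under eq_bigr do rewrite scale1r.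
rewrite (bigA_distr_bigA (fun _ (a : 'I_B.+1) => 'X^a)) /= coef_sum -sum1_card.
rewrite -natz natr_sum [RHS]big_mkcond; apply: eq_bigr => l _ /=.
by rewrite prodrXr coefXn eq_sym inE; case: eqP.
Qed.

Lemma series_mul_q_power (a : int) f n : series_mul (q_power a) f n = f (n - a).
Proof.
rewrite /series_mul -(fsbig_widen [set a]%classic [set: int]%classic) //=.
  by rewrite fsbig_set1 /q_power eqxx mul1r.
move=> b [_ /= ba]; rewrite /q_power.
by case: eqP => [e|_]; [case: ba | rewrite mul0r].
Qed.

(** As [v] is [q] times the geometric series in [q^-1], the coefficient of [q^n]
in [v^k] is that of [X^(k - n)] in the [k]th power of the geometric series, which
may be truncated at any degree [B] that is at least [k - n]. *)
Lemma series_exp_v k n B : k%:Z - n <= B%:Z ->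
  series_exp v_series k n =
  if n <= k%:Z then (geom B ^+ k)`_`|k%:Z - n| else 0.
Proof.
elim: k n => [|k IHk] n nB /=.
  rewrite /q_power expr0 coefC.
  by have [->//|n0] := eqVneq n 0; case: ifP => // n0'; case: eqP => //; lia.
set t := `|k.+1%:Z - n|%N; pose r := [seq 1 - a%:Z | a <- iota 0 t.+1].
have supp b : (b \notin r) || (n > k.+1%:Z) ->
    v_series b * series_exp v_series k (n - b) = 0.
  rewrite /v_series => h; case: ifP => b1; last by rewrite mul0r.
  rewrite mul1r IHk; last by lia.
  case: ifP => // nbk; case/orP: h => [|]; last by lia.
  by case/mapP; exists `|1 - b|%N; rewrite ?mem_iota; lia.
case: ifP => nk; last first.
  by rewrite /series_mul fsbig1 // => b _; apply: supp; apply/orP; right; lia.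
rewrite /series_mul (fsbigE r) //; first last.
- by move=> b _ nb; apply: supp; rewrite nb.
- by rewrite map_inj_uniq ?iota_uniq // => a b; lia.
rewrite (eq_bigl xpredT) => [|b]; last by rewrite classical_sets.in_setT.
rewrite exprS coefM -(big_mkord xpredT (fun a => (geom B)`_a * (geom B ^+ k)`_(t - a))).
rewrite big_map /index_iota subn0 big_seq [RHS]big_seq; apply: eq_bigr => a.
rewrite mem_iota => alt; rewrite /v_series coef_poly IHk; last by lia.
have -> : (1 - a%:Z <= 1) = true by lia.
have -> : (a < B.+1)%N by lia.
have -> : (n - (1 - a%:Z) <= k%:Z) = true by lia.
by rewrite !mul1r; congr (_`__); lia.
Qed.

(** Common summation bounds, which make evaluation visibly linear. *)
Lemma series_eval_bound (P : {poly {poly int}}) f n M K :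
  (size P <= M)%N -> (forall b, (size (P`_b)%R <= K)%N) ->
  series_eval P f n = \sum_(b < M) \sum_(a < K)
    P`_b`_a * series_exp f b (n - a%:Z).
Proof.
move=> PM PK; rewrite /series_eval.
pose F b a := P`_b`_a * series_exp f b (n - a%:Z).
have inner b L : (size (P`_b)%R <= L)%N ->
    \sum_(a < size P`_b) F b a = \sum_(a < L) F b a.
  move=> bL; rewrite (big_ord_widen _ (F b) bL).
  rewrite [RHS](bigID (fun a : 'I_L => (a < size (P`_b)%R)%N)) /=.
  rewrite [X in _ + X]big1 ?addr0 // => a; rewrite -leqNgt => ba.
  by rewrite /F (nth_default _ ba) mul0r.
transitivity (\sum_(b < size P) \sum_(a < K) F b a).
  apply: eq_bigr => b _; rewrite -(inner b K) //.
  by apply: eq_bigr => a _; rewrite series_mul_q_power.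
rewrite (big_ord_widen _ (fun b => \sum_(a < K) F b a) PM).
rewrite [RHS](bigID (fun b : 'I_M => (b < size P)%N)) /=.
rewrite [X in _ + X]big1 ?addr0 // => b; rewrite -leqNgt => Pb.
by rewrite big1 // => a _; rewrite (nth_default _ Pb) coef0 mul0r.
Qed.

Lemma coef_dichromatic (G : multigraph) b a : (dichromatic G)`_b`_a =
  \sum_(s : {set edge G} | (#|s| == a) && (ncomponents s == b)) (-1) ^+ #|s|.
Proof.
rewrite /dichromatic !coef_sum [RHS]big_mkcond; apply: eq_bigr => s _ /=.
rewrite coefCM coefXn mulr_natr coefMn.
rewrite -polyC1 -polyCN -polyC_exp coefCM coefXn mulr_natr -mulrnA mulnb.
by rewrite [a == _]eq_sym [b == _]eq_sym; case: (_ && _).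
Qed.

Lemma J_sum (G : multigraph) n : J G n =
  \sum_(s : {set edge G})
    (-1) ^+ #|s| * series_exp v_series (ncomponents s) (n - #|s|%:Z).
Proof.
pose P := dichromatic G.
pose M := (size P + #|vertex G|.+1)%N.
pose K := (\max_(b < size P) size (P`_b)%R + #|edge G|.+1)%N.
rewrite /J (@series_eval_bound _ _ _ M K) ?leq_addr //; last first.
  move=> b; apply: leq_trans (leq_addr _ _).
  have [bP|Pb] := ltnP b (size P); last by rewrite nth_default ?size_poly0.
  exact: (leq_bigmax (Ordinal bP)).
have kM s : (@ncomponents G s < M)%N.
  by rewrite ltn_addl // ltnS leq_imset_card.
have cK (s : {set edge G}) : (#|s| < K)%N.
  by rewrite ltn_addl // ltnS max_card.
under eq_bigr => b _ do under eq_bigr => a _ do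
  rewrite coef_dichromatic mulr_suml big_mkcond.
rewrite pair_bigA exchange_big /=; apply: eq_bigr => s _.
rewrite (bigD1 (Ordinal (kM s), Ordinal (cK s))) //= !eqxx /= big1 ?addr0 //.
case=> b a /=; rewrite xpair_eqE -!val_eqE /=.
by rewrite andbC [(_ : nat) == #|s|]eq_sym [(b : nat) == _]eq_sym => /negbTE ->.
Qed.

End Series.

(** * The graded Euler characteristic *)

(** For a fixed edge set with [k] components, [j] determines the sum of the labels
as [k - (j - i)], so both sides count the labelings with that sum. *)
Lemma size_states (G : multigraph) i (j : int) : (size (states G i j))%:Z =
  \sum_(s : {set edge G} | #|s| == i) series_exp v_series (ncomponents s) (j - i%:Z).
Proof.
set B := (i + #|vertex G| + `|j|)%N.
rewrite size_map -cardE -sum1_card.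
pose J s := {ffun {E | E \in @components G s} -> 'I_B.+1}.
pose Q s (l : J s) := jdeg (unbound (Tagged J l)) == j.
rewrite -natz natr_sum.
have -> : (\sum_(x in [pred x : bounded_state G B | (ideg (unbound x) == i) &&
      (jdeg (unbound x) == j)]) 1%:R : int) =
    \sum_(x : {s & J s} | (#|tag x| == i) && Q _ (tagged x)) 1%:R.
  by apply: eq_bigl; case.
rewrite -(@sig_big_dep _ _ _ _ _ (fun s : {set edge G} => #|s| == i) Q (fun _ _ => 1%:R)) /=.
apply: eq_bigr => s /eqP si.
have kG : (ncomponents s <= #|vertex G|)%N by rewrite leq_imset_card.
rewrite (@series_exp_v _ _ B); last by rewrite /B; lia.
have QE (l : J s) : Q s l = ((\sum_E l E)%N%:Z == (ncomponents s)%:Z - (j - i%:Z)).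
  rewrite /Q /jdeg /label_sum /= si.
  under eq_bigr do rewrite ffunE.
  by apply/eqP/eqP; lia.
case: ifP => jk; last by rewrite big1 // => l; rewrite QE => /eqP; lia.
have kE : ncomponents s = #|{: {E | E \in components s}}| by rewrite card_sig.
rewrite [in _ ^+ _]kE coef_geom_exp -natz -sum1_card natr_sum; apply: eq_bigl => l.
rewrite QE inE; apply/eqP/eqP => h; first by rewrite -h.
by rewrite h gez0_abs // subr_ge0.
Qed.

Theorem theorem5 (G : multigraph) (le : rel (edge G))
    (le_refl : reflexive le) (le_anti : antisymmetric le)
    (le_trans : transitive le) (le_total : total le) :
  has_graded_euler_characteristic #|edge G| (homology le) (J G).
Proof.
exists (fun i j => (hrank le j i)%:Z); split=> [i _ j|j].
  by exists (hrank le j i) => //; apply: has_rank_homology.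
have no_top : nstates G j #|edge G|.+1 = 0%N.
  apply/eqP; rewrite -eqz_nat /nstates size_states big_pred0 // => s.
  by apply/negbTE; rewrite neq_ltn ltnS max_card.
rewrite (euler_telescope le_anti le_total no_top) J_sum; symmetry.
under eq_bigr do rewrite /nstates size_states mulr_sumr.
rewrite big_mkord (exchange_big_dep xpredT) //=; apply: eq_bigr => s _.
have sE : (#|s| < #|edge G|.+1)%N by rewrite ltnS max_card.
by rewrite (big_pred1 (Ordinal sE)) // => i; rewrite -val_eqE eq_sym.
Qed.
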